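(* For every integer $n\ge 2$, \[ C(W_n)= 2^{n-1}-n+2+ \sum_{\substack{d\mid n-1\\ d>1}} d \sum_{(a_1,\ldots,a_k)} \Big(\prod_{i=1}^k C(P_{a_i-1})\Big)^{(n-1)/d}, \] where the inner sum runs over all Lyndon compositions $(a_1,\dots,a_k)$ of $d$.
   Context: For a finite labelled graph $G$, a composition of $G$ is a partition of the vertex set $V(G)$ into nonempty blocks such that each block induces a connected subgraph of $G$. $C(G)$ denotes the number of distinct compositions of $G$. $P_m$ is the path on $m$ vertices, so $C(P_m)=2^{m-1}$ for $m\ge1$, and by convention $C(P_0)=1$. The wheel graph $W_n$ (for $n\ge 4$) consists of a cycle $C_{n-1}$ on $n-1$ outer vertices together with one additional central vertex adjacent to every outer vertex; by convention $W_2$ is the path $P_2$ and $W_3$ is the triangle $C_3$. A composition of a positive integer $d$ is an ordered tuple $(a_1,\dots,a_k)$ of positive integers with $a_1+\dots+a_k=d$. A Lyndon composition of $d$ is a composition that is aperiodic (not equal to a concatenation of two or more copies of a shorter tuple) and is lexicographically strictly least among all its cyclic rotations $(a_j,\dots,a_k,a_1,\dots,a_{j-1})$. *)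

(* Defs.v *)
From mathcomp Require Import all_boot all_order.

Set Implicit Arguments.
Unset Strict Implicit.
Unset Printing Implicit Defensive.

Import DefaultSeqLexiOrder.

Record sgraph := SGraph {
  vertex :> finType;
  adj : rel vertex;
  adj_sym : symmetric adj;
  adj_irrefl : irreflexive adj
}.

Definition isomorphic (G H : sgraph) :=
  exists2 f : G -> H, bijective f & forall x y, adj (f x) (f y) = adj x y.

(* Connectedness of the subgraph induced by B: any two vertices of B are joined
   by a path all of whose vertices lie in B. *)
Definition induced_adj (G : sgraph) (B : {set G}) : rel G :=
  [rel x y | [&& x \in B, y \in B & adj x y]].

Definition induces_connected (G : sgraph) (B : {set G}) : bool :=
  [forall x in B, forall y in B, connect (induced_adj B) x y].

(* [partition] already requires the blocks to be nonempty. *)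
Definition graph_composition (G : sgraph) (P : {set {set G}}) : bool :=
  partition P [set: G] && [forall B in P, induces_connected B].

Definition num_compositions (G : sgraph) : nat :=
  #|[set P : {set {set G}} | graph_composition P]|.

Section Path.
Variable m : nat.

Definition path_adj : rel 'I_m := fun i j => (i.+1 == j) || (j.+1 == i).

Lemma path_adj_sym : symmetric path_adj.
Proof. by move=> i j; rewrite /path_adj orbC. Qed.

Lemma path_adj_irrefl : irreflexive path_adj.
Proof. by move=> i; rewrite /path_adj orbb eqn_leq ltnn. Qed.

Definition path_graph : sgraph := SGraph path_adj_sym path_adj_irrefl.

End Path.

Lemma num_compositions_path0 : num_compositions (path_graph 0) = 1.
Proof.
apply/eqP/cards1P; exists set0; apply/setP => P; rewrite !inE.
have no_block (B : {set path_graph 0}) : B = set0 by apply/setP => -[].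
apply/andP/eqP => [[/and3P[_ _ nP0] _] | ->].
  by apply/setP => B; rewrite (no_block B) inE (negbTE nP0).
split; last by apply/forall_inP => B; rewrite inE.
rewrite /partition /cover big_set0 eq_sym (no_block [set: _]) eqxx inE /= andbT.
by apply/trivIsetP => A B; rewrite inE.
Qed.

Section Cycle.
Variable m : nat.

(* The cycle for m >= 3. The clause i != j only matters for m = 1; for m = 1, 2
   this is the path on m vertices. *)
Definition cycle_adj : rel 'I_m := fun i j =>
  (i != j) && ((i.+1 %% m == j) || (j.+1 %% m == i)).

Lemma cycle_adj_sym : symmetric cycle_adj.
Proof. by move=> i j; rewrite /cycle_adj eq_sym orbC. Qed.

Lemma cycle_adj_irrefl : irreflexive cycle_adj.
Proof. by move=> i; rewrite /cycle_adj eqxx. Qed.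

Definition cycle_graph : sgraph := SGraph cycle_adj_sym cycle_adj_irrefl.

End Cycle.

Section Cone.
Variable G : sgraph.

Definition cone_adj : rel (option G) := fun u v =>
  match u, v with
  | Some x, Some y => adj x y
  | None, None => false
  | _, _ => true
  end.

Lemma cone_adj_sym : symmetric cone_adj.
Proof. by move=> [x|] [y|] //=; apply: adj_sym. Qed.

Lemma cone_adj_irrefl : irreflexive cone_adj.
Proof. by move=> [x|] //=; apply: adj_irrefl. Qed.

Definition cone : sgraph := SGraph cone_adj_sym cone_adj_irrefl.

End Cone.

(* None is the centre, Some i the i-th outer vertex. The small cases n = 2, 3
   follow the usual conventions, see wheel2 and wheel3. *)
Definition wheel (n : nat) : sgraph := cone (cycle_graph n.-1).

Lemma wheel2 : isomorphic (wheel 2) (path_graph 2).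
Proof.
pose f (u : wheel 2) : path_graph 2 := if u is Some _ then lift ord0 ord0 else ord0.
pose g (i : path_graph 2) : wheel 2 := if val i is 0 then None else Some ord0.
exists f; last by move=> [[[|i] lti]|] [[[|j] ltj]|].
by exists g; [move=> [i|] //; rewrite (ord1 i) | move=> [[|[|i]] lti] //; apply: val_inj].
Qed.

Lemma wheel3 : isomorphic (wheel 3) (cycle_graph 3).
Proof.
pose f (u : wheel 3) : cycle_graph 3 := if u is Some i then lift ord0 i else ord0.
pose g (i : cycle_graph 3) : wheel 3 := unlift ord0 i.
exists f; last by move=> [[[|[|i]] lti]|] [[[|[|j]] ltj]|].
exists g; first by move=> [i|]; rewrite /f /g ?liftK ?unlift_none.
by move=> i; rewrite /f /g; case: unliftP => [j|] ->.
Qed.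

Definition int_composition (d : nat) (a : seq nat) : bool :=
  all (leq 1) a && (sumn a == d).

(* A composition of d has at most d parts, each at most d. *)
Definition compositions (d : nat) : seq (seq nat) :=
  [seq a <- [seq map val t | t : d.-bseq 'I_d.+1] | int_composition d a].

Lemma mem_compositions d a : (a \in compositions d) = int_composition d a.
Proof.
rewrite mem_filter; case: (boolP (int_composition d a)) => //= /andP[a_gt0 /eqP <-].
have size_a : size a <= sumn a.
  by elim: a a_gt0 => //= x a IH /andP[x_gt0 /IH]; rewrite -add1n; apply: leq_add.
have le_a x : x \in a -> x < (sumn a).+1.
  rewrite ltnS; elim: a {a_gt0 size_a} => //= y a IH.
  rewrite inE => /orP[/eqP-> | /IH le_xa]; first exact: leq_addr.
  exact: leq_trans le_xa (leq_addl _ _).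
have size_t : size [seq inord x : 'I_(sumn a).+1 | x <- a] <= sumn a by rewrite size_map.
apply/imageP; exists (Bseq size_t) => //=.
by rewrite -map_comp -[LHS]map_id; apply/eq_in_map => x /le_a lt_x /=; rewrite inordK.
Qed.

Lemma compositions_uniq d : uniq (compositions d).
Proof.
apply/filter_uniq; rewrite map_inj_uniq ?enum_uniq // => s t eq_st.
by apply/val_inj/(inj_map val_inj).
Qed.

Definition aperiodic (a : seq nat) : bool :=
  ~~ [exists m : 'I_(size a), exists k : 'I_(size a).+1,
       (1 < k) && (a == flatten (nseq k (take m a)))].

Lemma aperiodicP a :
  reflect (~ exists b k, [/\ size b < size a, 1 < k & a = flatten (nseq k b)])
          (aperiodic a).
Proof.
apply: (iffP idP) => [/negP nex [b [k [lt_ba lt1k def_a]]] | nex]; last first.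
  apply/negP => /existsP[m /existsP[k /andP[lt1k /eqP def_a]]]; apply: nex.
  by exists (take m a), k; rewrite size_take ltn_ord.
have size_a : size a = k * size b.
  by rewrite def_a size_flatten /shape map_nseq sumn_nseq mulnC.
have b_gt0 : 0 < size b by case: (size b) size_a lt_ba => // ->; rewrite muln0.
have le_ka : k < (size a).+1 by rewrite ltnS size_a leq_pmulr.
have def_b : take (size b) a = b.
  by case: k lt1k def_a {size_a le_ka} => //= k _ ->; rewrite take_size_cat.
case: nex; apply/existsP; exists (Ordinal lt_ba); apply/existsP.
by exists (Ordinal le_ka); rewrite /= lt1k def_b -def_a eqxx.
Qed.

(* The order on seq nat is the lexicographic one; rot i a, 0 < i < size a,
   are the nontrivial cyclic rotations of a. *)
Definition lex_least_rotation (a : seq nat) : bool :=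
  [forall i : 'I_(size a), (0 < i) ==> (a < rot i a)%O].

Definition lyndon (a : seq nat) : bool := aperiodic a && lex_least_rotation a.

Definition lyndon_compositions (d : nat) : seq (seq nat) :=
  [seq a <- compositions d | lyndon a].

(* Main.v *)
(** Let m = n - 1. Recording the set S of rim vertices that share a block with
    the hub, together with the rim edges inside the other blocks, determines a
    composition of the wheel. Every set of rim edges avoiding S can occur,
    except that for empty S it cannot miss exactly one rim edge, since the m - 1
    others already connect the rim. Hence C(W_n) + m is the sum over S of
    2 ^ #{i | i, i+1 notin S}. The empty S contributes 2 ^ m; a nonempty S is
    a composition b of m (the cyclic gaps of S) with an offset smaller than the
    first part of b. Every composition of m is uniquely a power of a rotation of
    a Lyndon composition a of some d | m, and the first parts of the rotations
    of a sum to d. *)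

Require Import Defs.
From mathcomp Require Import all_boot all_order all_algebra zify.
Set Implicit Arguments.
Unset Strict Implicit.
Unset Printing Implicit Defensive.
Import DefaultSeqLexiOrder.

(** * Counting compositions through an encoding *)

(* [code] reads data off a same-block relation, while the edges [dec t] generate
   the same-block relation of the composition encoded by [t]. *)
Lemma num_compositions_code (G : sgraph) (D : finType) (good : pred D)
    (code : rel G -> D) (dec : D -> rel G) :
  (forall q q', q =2 q' -> code q = code q') ->
  (forall t, symmetric (dec t)) ->
  (forall t x y, dec t x y -> x != y -> adj x y) ->
  (forall q, equivalence_rel q ->
     [/\ good (code q), forall x y, dec (code q) x y -> q x y
       & forall x y, adj x y -> q x y -> connect (dec (code q)) x y]) ->
  (forall t, good t -> code (connect (dec t)) = t) ->
  num_compositions G = #|good|.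
Proof.
move=> code_ext dec_sym dec_adj codeP decK.
pose R t := connect (dec t).
pose part t := equivalence_partition (R t) [set: G].
have R_equiv t : equivalence_rel (R t).
  apply/equivalence_relP; split=> [x|x y xy z]; rewrite /R ?connect0 //.
  by rewrite (same_connect (sym_connect_sym (dec_sym t)) xy).
have R_equivT t : {in [set: G] & &, equivalence_rel (R t)}.
  by move=> x y z _ _ _; apply: R_equiv.
have partE t x y : (y \in pblock (part t) x) = R t x y.
  by rewrite pblock_equivalence_partition ?inE.
rewrite -(card_in_imset (f := part) (D := good)).
  rewrite /num_compositions; apply: eq_card => P; rewrite !inE.
  apply/idP/imsetP => [/andP[partP /forall_inP conP] | [t good_t ->]].
    pose q := fun x y => y \in pblock P x.
    have q_equiv : equivalence_rel q.
      by move=> x y z; apply: (pblock_equivalence partP); rewrite inE.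
    have [good_q dec_q adj_q] := codeP q q_equiv.
    exists (code q) => //.
    rewrite -[LHS](equivalence_partition_pblock partP).
    have q_eq x y : q x y = R (code q) x y.
      have /equivalence_relP[q_refl q_tr] := q_equiv.
      apply/idP/idP => [xy|].
        have cov : cover P = [set: G] by case/and3P: partP => /eqP.
        have Bx : pblock P x \in P by rewrite pblock_mem // cov inE.
        have /forall_inP/(_ x) := conP _ Bx; rewrite mem_pblock cov inE => /(_ isT).
        (* A path inside the block is refined edge by edge: [adj_q] replaces each edge by a
           [dec]-path. *)
        move=> /forall_inP/(_ y xy); apply: connect_sub => u v /= /and3P[xu xv uv].
        by apply: adj_q => //; rewrite -(q_tr _ _ xu).
      case/connectP => p; elim: p x => [|z p IH] x /= => [_ ->|]; first exact: q_refl.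
      by move=> /andP[/dec_q/q_tr-> /IH].
    rewrite /part /equivalence_partition; apply: eq_imset => x; apply/setP => y.
    by rewrite !inE -q_eq.
  rewrite /graph_composition equivalence_partitionP //=.
  apply/forall_inP => B partB; apply/forall_inP => x Bx; apply/forall_inP => y By.
  have tB : trivIset (part t) by case/and3P: (equivalence_partitionP (R_equivT t)).
  have defB : B = [set z | R t x z].
    by rewrite -(def_pblock tB partB Bx); apply/setP => z; rewrite partE inE.
  move: By; rewrite defB inE.
  (* All prefixes of a [dec t]-path from [x] end in the class of [x], so the path stays inside [B].
     Loops of [dec t] are skipped, as [dec_adj] speaks of distinct ends. *)
  case/connectP => p; elim/last_ind: p y => [|p z IH] y /= => [_ ->|]; first exact: connect0.
  rewrite rcons_path last_rcons => /andP[pp pz] ->.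
  have xl : R t x (last x p) by apply/connectP; exists p.
  have xz : R t x z := connect_trans xl (connect1 pz).
  apply: connect_trans (IH _ pp erefl) _.
  have [->|neq] := eqVneq (last x p) z; first exact: connect0.
  by apply: connect1; rewrite /induced_adj /= !inE -!/(R t _ _) xl xz (dec_adj t).
move=> t t' good_t good_t' eq_part; rewrite -(decK t) // -(decK t') //.
by apply: code_ext => x y; rewrite -!/(R _ _ _) -!partE eq_part.
Qed.

(** * Cycle edges and the compositions of a path *)

(* An index [i] also stands for the edge of the cycle from [i] to [ordS i]. *)
Definition joined m (T : {set 'I_m}) : rel 'I_m :=
  [rel x y | (x \in T) && (y == ordS x) || (y \in T) && (x == ordS y)].

Lemma joined_sym m (T : {set 'I_m}) : symmetric (joined T).
Proof. by move=> x y; rewrite /joined /= orbC. Qed.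

Lemma joined_ordS m (T : {set 'I_m}) x : x \in T -> joined T x (ordS x).
Proof. by move=> Tx; rewrite /joined /= Tx eqxx. Qed.

Lemma joined_closed m (T : {set 'I_m}) (A : {pred 'I_m}) :
  {in T, forall x, (ordS x \in A) = (x \in A)} -> closed (joined T) A.
Proof. by move=> clA x y /orP[] /andP[/clA eqA /eqP->]. Qed.

(** Dropping one edge of a path already separates its ends, so any set of edges is exactly the set
    of edges inside the blocks of one composition. *)
Lemma num_compositions_path m : num_compositions (path_graph m) = 2 ^ m.-1.
Proof.
case: m => [|m]; first exact: num_compositions_path0.
(* The edge at the last vertex wraps around to [0] and does not belong to the path. *)
pose inner := [set i : 'I_m.+1 | i.+1 < m.+1].
have ordS_inner i : i \in inner -> ordS i = i.+1 :> nat.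
  by rewrite inE => lt_im; rewrite /= modn_small.
pose good := [pred T : {set 'I_m.+1} | T \subset inner].
pose code (q : rel (path_graph m.+1)) := [set i in inner | q i (ordS i)].
pose dec (T : {set 'I_m.+1}) : rel (path_graph m.+1) := joined (T :&: inner).
rewrite (@num_compositions_code _ _ good code dec).
- transitivity #|powerset inner|; first by apply: eq_card => T; rewrite !inE.
  rewrite card_powerset; congr (2 ^ _).
  have ->: inner = [set~ ord_max].
    by apply/setP => i; rewrite !inE -val_eqE /=; have := ltn_ord i; lia.
  by rewrite cardsC1 card_ord.
- by move=> q q' eq_q; apply/setP => i; rewrite !inE eq_q.
- by move=> T; apply: joined_sym.
- move=> T x y; rewrite /dec /joined /= => /orP[] /andP[/setIP[_ /ordS_inner eqS] /eqP->] _;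
  by rewrite /= /path_adj eqS eqxx ?orbT.
- move=> q /equivalence_relP[q_refl q_tr]; split.
  + by apply/subsetP => i; rewrite inE => /andP[].
  + move=> x y /orP[] /andP[/setIP[]] /[1!inE] /andP[_ qS] _ /eqP-> //.
    by rewrite -(q_tr _ _ qS).
  + move=> x y; rewrite /= /path_adj => xy qxy.
    wlog xSy : x y xy qxy / x.+1 == y :> nat.
      move=> IH; case/orP: (xy) => [|yx]; first exact: IH.
      rewrite sym_connect_sym; last exact: joined_sym.
      by apply: IH => //; rewrite ?yx // -(q_tr _ _ qxy).
    have inx : x \in inner by rewrite inE (eqP xSy).
    have eqy : y = ordS x by apply: ord_inj; rewrite ordS_inner // (eqP xSy).
    rewrite eqy in qxy *; apply: connect1; apply: joined_ordS.
    by rewrite !inE in inx *; rewrite inx qxy.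
- move=> T /= sTi; apply/setP => i; rewrite inE; apply/andP/idP => [[inn_i]|Ti]; last first.
    rewrite (subsetP sTi) //; split=> //; apply/connect1/joined_ordS.
    by rewrite inE Ti (subsetP sTi).
  apply: contraTT => notTi.
  (* Without the edge at [i], no edge leaves the initial segment that ends in [i]. *)
  have cl : closed (dec T) [pred k : 'I_m.+1 | k <= i].
    apply: joined_closed => k /setIP[Tk inn_k].
    rewrite /= !inE ordS_inner //.
    have : k != i by apply: contraNneq notTi => <-.
    by rewrite -val_eqE /=; lia.
  by apply/negP => /(closed_connect cl); rewrite /= !inE ordS_inner // leqnn ltnn.
Qed.

(** * Compositions of the wheel *)

Definition free_edges m (S : {set 'I_m}) : {set 'I_m} :=
  [set i | (i \notin S) && (ordS i \notin S)].

Lemma val_ordS m (i : 'I_m) : ordS i = (if i.+1 < m then i.+1 else 0) :> nat.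
Proof.
case: ltnP => /= [/modn_small // | le_mi].
by have /eqP-> : i.+1 == m by [rewrite eqn_leq ltn_ord]; rewrite modnn.
Qed.

(* Deleting two edges of the cycle leaves two arcs. *)
Lemma joined_separated m (T : {set 'I_m}) (i j : 'I_m) :
    i \notin T -> j \notin T -> i != j ->
  exists2 A : {set 'I_m}, closed (joined T) A & (ordS i \in A) != (i \in A).
Proof.
move=> notTi notTj neq_ij.
(* The arc from [lo + 1] to [hi] can be left only through the edges indexed by [lo] and [hi]. *)
pose lo := minn i j; pose hi := maxn i j.
exists [set k : 'I_m | lo < k <= hi].
  apply: joined_closed => k Tk.
  have : (k != i) && (k != j).
    by apply/andP; split; [apply: contraNneq notTi | apply: contraNneq notTj] => <-.
  rewrite !inE val_ordS -!val_eqE /= /lo /hi.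
  by have := ltn_ord k; have := ltn_ord i; have := ltn_ord j; case: ifP; lia.
move: neq_ij; rewrite !inE val_ordS -val_eqE /= /lo /hi.
by have := ltn_ord i; have := ltn_ord j; case: ifP; lia.
Qed.

(** From [ordS i], going [m.-1] steps around the cycle leads back to [i] without using the edge at
    [i]. *)
Lemma ordS_chain m (q : rel 'I_m) i :
    equivalence_rel q -> {in [set~ i], forall j, q j (ordS j)} ->
  q i (ordS i).
Proof.
move=> /equivalence_relP[q_refl q_tr] qS.
have m_gt0 : 0 < m := leq_ltn_trans (leq0n i) (ltn_ord i).
have iterE k : iter k (@ordS m) (ordS i) = (i + k.+1) %% m :> nat.
  elim: k => [|k IHk]; first by rewrite addn1.
  by rewrite iterS [LHS]/= IHk -[(_ %% m).+1]addn1 modnDml addn1 !addnS.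
have qk k : k < m -> q (ordS i) (iter k (@ordS m) (ordS i)).
  elim: k => [|k IH] lt_km; first exact: q_refl.
  rewrite (q_tr _ _ (IH (ltnW lt_km))) /=; apply: qS.
  rewrite !inE -val_eqE /= iterE; apply/eqP => eq_i.
  have : i + k.+1 == i %[mod m] by rewrite eq_i modn_small.
  by rewrite -[X in _ == X %[mod _]]addn0 eqn_modDl mod0n modn_small.
have iter_i : iter m.-1 (@ordS m) (ordS i) = i.
  by apply: ord_inj; rewrite iterE prednK // modnDr modn_small.
have qi : q (ordS i) i by rewrite -[X in q _ X]iter_i qk // prednK.
by rewrite -(q_tr _ _ qi).
Qed.

Lemma num_compositions_wheel m :
  num_compositions (wheel m.+2) + m.+1 = \sum_(S : {set 'I_m.+1}) 2 ^ #|free_edges S|.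
Proof.
pose D : finType := ({set 'I_m.+1} * {set 'I_m.+1})%type.
pose valid := [pred t : D | t.2 \subset free_edges t.1].
(* There are [m.+1] rim edges, so [T] misses exactly one of them, and there are [m.+1] bad codes. *)
pose bad := [pred t : D | (t.1 == set0) && (#|t.2| == m)].
pose good := [pred t : D | valid t && ~~ bad t].
pose code (q : rel (wheel m.+2)) : D :=
  let S := [set i | q None (Some i)] in
  (S, [set i in free_edges S | q (Some i) (Some (ordS i))]).
pose dec (t : D) : rel (wheel m.+2) := fun x y =>
  match x, y with
  | Some i, Some j => joined (t.2 :&: free_edges t.1) i j
  | Some i, None | None, Some i => i \in t.1
  | None, None => false
  end.
have dec_sym t : symmetric (dec t) by move=> [i|] [j|] //; apply: joined_sym.
have free0 : free_edges set0 = [set: 'I_m.+1] by apply/setP => i; rewrite !inE.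
rewrite (@num_compositions_code _ _ good code dec) //.
- have card_bad : #|bad| = m.+1.
    rewrite -[RHS]binSn -[X in 'C(X, _)]card_ord -card_draws.
    rewrite -(card_imset _ (f := fun T => (set0, T) : D)) => [|T T' [] //].
    apply: eq_card => -[S T]; rewrite !inE /=.
    apply/andP/imsetP => [[/eqP-> cT]|[T' cT' [-> ->]]].
      by exists T; rewrite ?inE.
    by rewrite eqxx; split=> //; rewrite inE in cT'.
  transitivity #|valid|.
    rewrite -(cardID bad valid) addnC -card_bad; congr (_ + _); apply: eq_card => t.
      rewrite [RHS]inE andb_idl // !inE => /andP[/eqP-> _].
      by rewrite free0 subsetT.
    by rewrite !inE andbC.
  under eq_bigr => S _ do rewrite -card_powerset -sum1_card.
  rewrite pair_big_dep -sum1_card; apply: eq_bigl => t.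
  by rewrite inE /= inE.
- move=> q q' eq_q; rewrite /code; congr (_, _); last first.
    by apply/setP => i; rewrite !inE !eq_q.
  by apply/setP => i; rewrite !inE eq_q.
- move=> t [x|] [y|] //= /orP[] /andP[_ /eqP eS] neq;
  by rewrite /cycle_adj [x != y]neq eS /= eqxx ?orbT.
- move=> q q_equiv; have /equivalence_relP[q_refl q_tr] := q_equiv.
  have q_sym x y : q x y = q y x.
    by apply/idP/idP => xy; rewrite -(q_tr _ _ xy).
  split.
  + rewrite !inE; apply/andP; split.
      by apply/subsetP => i; rewrite inE => /andP[].
    apply/negP => /andP[/eqP S0]; rewrite /= in S0.
    rewrite /= S0 free0 => /eqP cT.
    set T := [set i in _ | _] in cT.
    have cTC : #|~: T| = 1 by have := cardsC T; rewrite cT card_ord; lia.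
    have /cards1P[i TC] : #|~: T| == 1 by rewrite cTC.
    have qS : {in [set~ i], forall j, q (Some j) (Some (ordS j))}.
      by move=> j; rewrite -TC setCK !inE.
    have : i \in ~: T by rewrite TC inE.
    rewrite !inE => /negP; apply.
    apply: (@ordS_chain _ (fun j k => q (Some j) (Some k))) qS => x y z.
    exact: q_equiv.
  + move=> [x|] [y|] //=.
    * by case/orP=> /andP[] /setIP[] /[1!inE] /andP[_ qS] _ /eqP-> //; rewrite q_sym.
    * by rewrite !inE q_sym.
    * by rewrite !inE.
  + move=> x y.
    have cN i : q None (Some i) -> connect (dec (code q)) None (Some i).
      by move=> qi; apply: connect1; rewrite /= !inE.
    have cS := sym_connect_sym (dec_sym (code q)).
    case: x y => [x|] [y|] //=; last 2 first.
    * by move=> _; rewrite cS q_sym; apply: cN.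
    * by move=> _; apply: cN.
    move=> xy qxy.
    wlog xSy : x y xy qxy / y = ordS x.
      case/andP: (xy) => _ /orP[]/eqP e IH; first by apply: IH => //; apply: ord_inj.
      by rewrite cS; apply: IH; rewrite 1?cycle_adj_sym 1?q_sym //; apply: ord_inj.
    (* Rim vertices in the hub's block are linked through the hub; otherwise the edge itself is free
       and recorded. *)
    have [qx|nqx] := boolP (q None (Some x)).
      by apply: (connect_trans _ (cN y _)); rewrite ?(q_tr _ _ qx) // cS; apply: cN.
    apply: connect1; rewrite xSy; apply: joined_ordS.
    have nqy : ~~ q None (Some y) by rewrite q_sym -(q_tr _ _ qxy) q_sym.
    by rewrite !inE -xSy nqx nqy qxy.
move=> [S T] /andP[/= sTf nbad]; rewrite /code.
have TI : T :&: free_edges S = T by apply/setIidPl.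
have free_S i : i \in T -> (i \notin S) && (ordS i \notin S).
  by move=> /(subsetP sTf); rewrite inE.
have defS : [set i | connect (dec (S, T)) None (Some i)] = S.
  apply/setP => i; rewrite inE; apply/idP/idP => [|Si]; last by apply: connect1.
  (* Edges in [T] avoid [S], so nothing leaves the hub together with [S]. *)
  pose A := [set x : wheel m.+2 | if x is Some i then i \in S else true].
  have cl : closed (dec (S, T)) A.
    apply: intro_closed; first exact/sym_connect_sym.
    move=> [x|] [y|]; rewrite !inE //= TI => /orP[] /andP[/free_S/andP[nS nSS] /eqP->].
      by rewrite (negbTE nS).
    by rewrite (negbTE nSS).
  by move/(closed_connect cl); rewrite !inE => /esym.
congr (_, _); rewrite ?defS //; apply/setP => i; rewrite inE.
apply/andP/idP => [[fi]|Ti]; last first.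
  by rewrite (subsetP sTf) //; split=> //; apply/connect1; rewrite /= TI joined_ordS.
apply: contraTT => notTi.
(* A second missing edge is needed to cut the rim. A vertex of [S] supplies one, since the edge at
   it is not free; for empty [S] it exists because the code is not bad. *)
have [j notTj neq_ij] : exists2 j, j \notin T & i != j.
  have [S0|[j Sj]] := set_0Vmem S; last first.
    exists j; first by apply: contraTN Sj => /free_S/andP[].
    by apply: contraTneq Sj => <-; move: fi; rewrite inE => /andP[].
  have cTC : 1 < #|~: T|.
    have := cardsC T; rewrite card_ord.
    have : #|T| != m by move: nbad; rewrite S0 eqxx.
    have : 0 < #|~: T| by apply/card_gt0P; exists i; rewrite inE.
    lia.
  have : 0 < #|~: T :\ i| by have := cardsD1 i (~: T); rewrite inE notTi; lia.
  by case/card_gt0P => j; rewrite !inE => /andP[neq nT]; exists j; rewrite // eq_sym.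
have [A clA neqA] := joined_separated notTi notTj neq_ij.
(* The hub is linked only to [S], so an arc stripped of [S] remains closed in the wheel. *)
pose B := [set x : wheel m.+2 | if x is Some k then (k \in A) && (k \notin S) else false].
have clB : closed (dec (S, T)) B.
  move=> [x|] [y|] //=; rewrite !inE ?TI; last 2 first.
  - by move=> ->; rewrite andbF.
  - by move=> ->; rewrite andbF.
  move=> xy; rewrite (clA _ _ xy); congr (_ && _).
  by case/orP: xy => /andP[/free_S/andP[nS nSS] /eqP->]; rewrite nS nSS.
apply: contraNN neqA => /(closed_connect clB); rewrite !inE.
by move: fi; rewrite inE => /andP[-> ->]; rewrite !andbT => ->.
Qed.

(** * Binary words and cyclic gaps *)

(* A part x is spelled 0^(x-1) 1. *)
Definition spell (b : seq nat) : seq bool :=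
  flatten [seq rcons (nseq x.-1 false) true | x <- b].

Lemma spell_cons x b : spell (x :: b) = nseq x.-1 false ++ true :: spell b.
Proof. by rewrite /spell /= cat_rcons. Qed.

Lemma size_spell b : all (leq 1) b -> size (spell b) = sumn b.
Proof.
elim: b => // x b IH /= /andP[x_gt0 /IH]; rewrite spell_cons size_cat size_nseq /=.
by move=> ->; rewrite addnS -addSn prednK.
Qed.

(* Splits a word as [spell b] followed by k trailing zeros. *)
Fixpoint gaps (w : seq bool) : seq nat * nat :=
  if w is c :: w' then
    let: (b, k) := gaps w' in
    if c then (1 :: b, k) else if b is x :: b' then (x.+1 :: b', k) else ([::], k.+1)
  else ([::], 0).

(** Together with [gapsP], this gives a bijection between words and pairs of a list of positive
    parts and a number of trailing zeros. *)
Lemma spellK b k : all (leq 1) b -> gaps (spell b ++ nseq k false) = (b, k).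
Proof.
elim: b => [_|x b IH /= /andP[x_gt0 /IH]]; first by elim: k => //= k ->.
rewrite spell_cons -catA; case: x x_gt0 => //= x _.
by elim: x => [|x IHx] gaps_b /=; rewrite ?gaps_b ?IHx.
Qed.

Lemma gapsP w b k :
  gaps w = (b, k) -> all (leq 1) b /\ spell b ++ nseq k false = w.
Proof.
elim: w b k => [|c w IH] b k /=; first by move=> [<- <-].
case: (gaps w) IH => b1 k1 /(_ _ _ erefl)[b1_pos <-].
case: c => [[<- <-]|]; first by rewrite spell_cons.
case: b1 b1_pos => [_ [<- <-] // | x b1 /= /andP[x_gt0 b1_pos] [<- <-]].
by rewrite !spell_cons; case: x x_gt0.
Qed.

(** The first block has [x.-1] zeros before its one, so an offset below [x] moves only zeros to the
    end, where it can be read off. *)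
Lemma rot_spell o x b :
  o < x -> rot o (spell (x :: b)) = spell (x - o :: b) ++ nseq o false.
Proof.
move=> lt_ox; have {1}->: x = o + (x - o).-1.+1 by lia.
by rewrite !spell_cons /= addnS /= nseqD -catA -{1}(size_nseq o false) rot_size_cat -catA.
Qed.

Definition indicator m (S : {set 'I_m}) : seq bool := [seq i \in S | i <- enum 'I_m].

(** Nonempty sets are the words with at least one [true]. Cyclically, the trailing zeros belong to
    the first gap, and their number is the offset. *)
Lemma sum_nonempty_sets (F : seq bool -> nat) m : 0 < m ->
  \sum_(S : {set 'I_m} | S != set0) F (indicator S) =
  \sum_(b <- compositions m) \sum_(o <- iota 0 (head 0 b)) F (rot o (spell b)).
Proof.
move=> m_gt0.
rewrite -[RHS](big_allpairs_dep (h := fun b o => rot o (spell b)) (F := F)).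
rewrite -big_enum /= -(big_map (@indicator m) xpredT F); apply: perm_big.
apply: uniq_perm => [||w].
- rewrite map_inj_uniq ?enum_uniq // => S S' /eq_in_map eqS.
  by apply/setP => i; apply: eqS; rewrite mem_enum.
- apply: allpairs_uniq_dep => [|b _|]; [exact: compositions_uniq | exact: iota_uniq |].
  move=> p p' /allpairsPdep[b [o [b_comp lt_o ->]]].
  move=> /allpairsPdep[b' [o' [b'_comp lt_o' ->]]] /=.
  rewrite !mem_iota !add0n /= !mem_compositions in b_comp b'_comp lt_o lt_o'.
  case/andP: b_comp => b_pos _; case/andP: b'_comp => b'_pos _.
  case: b b_pos lt_o => // x b /= /andP[_ b_pos] lt_o.
  case: b' b'_pos lt_o' => // x' b' /= /andP[_ b'_pos] lt_o'.
  (* [gaps] recovers [x - o], [b] and [o], and these determine [x]. *)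
  rewrite !rot_spell // => /(congr1 gaps).
  rewrite !spellK /= ?subn_gt0 ?lt_o ?lt_o' // => -[eq_x -> eq_o].
  by rewrite eq_o in eq_x lt_o *; have -> : x = x' by lia.
apply/mapP/allpairsPdep => [[S] | [b [o []]]].
  rewrite mem_enum => /set0Pn[i Si] def_w.
  have size_w : size w = m by rewrite def_w size_map size_enum_ord.
  have w_true : true \in w by rewrite def_w; apply/mapP; exists i; rewrite ?mem_enum.
  case def_g: (gaps w) => [[|x b] k]; have [b_pos def_w'] := gapsP def_g.
    by move: w_true; rewrite -def_w' mem_nseq andbF.
  rewrite /= in b_pos; case/andP: b_pos => x_gt0 b_pos.
  have lt_k : k < x + k by rewrite -{1}[k]add0n ltn_add2r.
  (* The [k] trailing zeros lengthen the first gap from [x] to [x + k]. *)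
  exists (x + k :: b), k; split.
  - rewrite mem_compositions /int_composition /= addn_gt0 x_gt0 b_pos /=.
    rewrite -size_w -def_w' size_cat size_nseq size_spell /= ?x_gt0 //.
    by rewrite addnAC.
  - by rewrite mem_iota.
  - by rewrite rot_spell // addnK.
rewrite mem_compositions => /andP[b_pos /eqP sum_b]; rewrite mem_iota add0n /= => lt_o def_w.
have size_w : size w = m by rewrite def_w size_rot size_spell.
exists [set i : 'I_m | nth false w i]; last first.
  apply: (@eq_from_nth _ false) => [|i]; rewrite size_w.
    by rewrite size_map size_enum_ord.
  move=> lt_i.
  by rewrite (nth_map (Ordinal lt_i)) ?size_enum_ord // inE nth_enum_ord.
have : true \in w.
  rewrite def_w mem_rot; case: b lt_o {b_pos sum_b def_w} => // x b _.
  by rewrite spell_cons mem_cat inE eqxx orbT.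
case/(nthP false) => i; rewrite size_w => lt_i w_i.
by rewrite mem_enum; apply/set0Pn; exists (Ordinal lt_i); rewrite inE.
Qed.

(** * Adjacent zeros in cyclic words *)

(* [p] is the letter preceding [w]. *)
Fixpoint zero_pairs (p : bool) (w : seq bool) : nat :=
  if w is c :: w' then (~~ p && ~~ c) + zero_pairs c w' else 0.

Definition cyclic_zero_pairs w := zero_pairs (last true w) w.

Lemma zero_pairs_cat p s t : zero_pairs p (s ++ t) = zero_pairs p s + zero_pairs (last p s) t.
Proof. by elim: s p => //= c s IH p; rewrite IH addnA. Qed.

(** Cutting at [k] gives two pieces, each preceded cyclically by the last letter of the other;
    rotation only swaps their counts. *)
Lemma cyclic_zero_pairs_rot k w : cyclic_zero_pairs (rot k w) = cyclic_zero_pairs w.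
Proof.
rewrite -{2}(cat_take_drop k w) /rot /cyclic_zero_pairs.
case: (take k w) (drop k w) => [|c s] [|d t]; rewrite ?cats0 //.
by rewrite !zero_pairs_cat !last_cat /= addnC.
Qed.

(** A part [x] gives a run of [x - 1] zeros closed by a one, hence [(x - 1).-1] adjacent pairs, and
    no pair straddles two parts. *)
Lemma cyclic_zero_pairs_spell b :
  cyclic_zero_pairs (spell b) = \sum_(x <- b) (x - 1).-1.
Proof.
(* [spell b] is empty or ends in [true], so no pair wraps around. *)
have -> : cyclic_zero_pairs (spell b) = zero_pairs true (spell b).
  rewrite /cyclic_zero_pairs; congr (zero_pairs _ _).
  by elim: b => // x b IH; rewrite spell_cons last_cat.
elim: b => [|x b IH]; first by rewrite big_nil.
rewrite big_cons -IH spell_cons zero_pairs_cat /= andbF add0n; congr (_ + _).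
rewrite subn1; case: (x.-1) => //= y.
by rewrite add0n; elim: y => //= y ->.
Qed.

Lemma card_free_edges m (S : {set 'I_m}) :
  #|free_edges S| = cyclic_zero_pairs (indicator S).
Proof.
set w := indicator S.
have size_w : size w = m by rewrite size_map size_enum_ord.
have nth_w (i : 'I_m) : nth false w i = (i \in S).
  by rewrite (nth_map i) ?size_enum_ord // nth_ord_enum.
have -> : #|free_edges S| = \sum_(i < m) (~~ nth false w i && ~~ nth false w (i.+1 %% m)).
  rewrite -sum1_card big_mkcond; apply: eq_bigr => i _.
  by rewrite inE -!nth_w /=; case: (_ && _).
have pairsE p v k : size v = k.+1 ->
    zero_pairs p v = (~~ p && ~~ nth false v 0)
      + \sum_(i < k) (~~ nth false v i && ~~ nth false v i.+1).
  elim: k p v => [|k IH] p [|c v] //= [size_v].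
    by rewrite big_ord0; case: v size_v.
  by rewrite (IH _ _ size_v) big_ord_recl.
clearbody w; case: m S size_w nth_w => [|m] _ size_w _.
  by rewrite (size0nil size_w) big_ord0.
(* The edge from the last index to [0] is the first pair tested by [zero_pairs]. *)
rewrite /cyclic_zero_pairs (pairsE _ _ _ size_w) big_ord_recr /= modnn addnC; congr (_ + _).
  by rewrite -nth_last (set_nth_default false) size_w.
by apply: eq_bigr => i _; rewrite modn_small // ltnS.
Qed.

(** * Powers and rotations of words *)

Section Repetition.
Variable T : eqType.
Implicit Types b c u v : seq T.

Definition rep k c := flatten (nseq k c).

Lemma repS k c : rep k.+1 c = c ++ rep k c. Proof. by []. Qed.

Lemma size_rep k c : size (rep k c) = k * size c.
Proof. by rewrite size_flatten /shape map_nseq sumn_nseq mulnC. Qed.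

Lemma cat_rep k u v : u ++ rep k (v ++ u) = rep k (u ++ v) ++ u.
Proof. by elim: k => [|k IH]; rewrite ?cats0 // !repS -!catA IH. Qed.

Lemma rot_rep k i c : i <= size c -> rot i (rep k c) = rep k (rot i c).
Proof.
case: k => [|k] le_ic; first by case: i le_ic.
rewrite -{1}(cat_take_drop i c) /(rot i c) !repS -catA.
by rewrite -{1}(size_takel le_ic) rot_size_cat -!catA cat_rep.
Qed.

Lemma rot_rep_mod k i c :
  i <= size (rep k c) -> rot i (rep k c) = rep k (rot (i %% size c) c).
Proof.
have [/size0nil-> | c_gt0] := posnP (size c).
  by rewrite size_rep muln0 leqn0 => /eqP->; rewrite !rot0.
rewrite {1 2}(divn_eq i (size c)); elim: (i %/ _) => [|q IH] le_i.
  by rewrite rot_rep // ltnW ?ltn_mod.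
rewrite mulSn -addnA in le_i *; rewrite rotD // IH ?(leq_trans (leq_addl _ _) le_i) //.
by rewrite rot_rep ?size_rot // [in rot (size c) _]rot_oversize ?size_rot.
Qed.

Lemma rep_inj k c c' : 0 < k -> size c = size c' -> rep k c = rep k c' -> c = c'.
Proof.
by case: k => // k _ eq_size /eqP; rewrite !repS eqseq_cat // => /andP[/eqP].
Qed.

(** Commuting makes [u] a prefix of [v]; cancelling it leaves a word that still commutes with [u],
    with [q] lowered by one. *)
Lemma comm_rep q u v : u ++ v = v ++ u -> size v = q * size u -> v = rep q u.
Proof.
elim: q v => [|q IH] v uv size_v; first exact: size0nil.
have le_uv : size u <= size v by rewrite size_v leq_addr.
have def_v : v = u ++ drop (size u) v.
  rewrite -[LHS](cat_take_drop (size u)); congr (_ ++ _).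
  by rewrite -(takel_cat u le_uv) -uv take_size_cat.
rewrite def_v repS; congr (_ ++ _); apply: IH; last by rewrite size_drop size_v addKn.
have : u ++ (u ++ drop (size u) v) == u ++ (drop (size u) v ++ u).
  by rewrite -def_v [eqbRHS]catA -def_v uv.
by rewrite eqseq_cat // => /andP[_ /eqP].
Qed.

(** Rotation by the remainder of [size b] modulo [n] also fixes [b], so minimality makes [n] divide
    [size b]; then [comm_rep] applies. *)
Lemma rot_fix_rep n b :
    0 < n -> rot n b = b -> (forall i, 0 < i < n -> rot i b != b) ->
  exists2 q, b = rep q (take n b) & size b = q * n.
Proof.
move=> n_gt0 rot_n min_n.
(* Rotation by the full length fixes [b], so minimality allows [n] to exceed it only for empty
   [b]. *)
have [n_le|b_lt] := leqP n (size b); last first.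
  have /size0nil-> : size b = 0; last by exists 0.
  apply/eqP; rewrite eqn0Ngt; apply/negP => b_gt0.
  by have := min_n (size b); rewrite b_gt0 b_lt rot_size eqxx => /(_ isT).
have rot_qn q : q * n <= size b -> rot (q * n) b = b.
  elim: q => [|q IH] le_q; first by rewrite rot0.
  by rewrite mulSn rotD // IH // (leq_trans _ le_q) // leq_mul2r leqnSn orbT.
have size_b : size b = (size b %/ n) * n.
  rewrite divnK // /dvdn eqn0Ngt; apply/negP => r_gt0.
  have := min_n (size b %% n); rewrite r_gt0 ltn_mod n_gt0 => /(_ isT)/negP; case.
  rewrite -{2}(rot_qn (size b %/ n)) ?leq_trunc_div // -rotD.
    by rewrite addnC -divn_eq rot_size.
  by rewrite addnC -divn_eq.
exists (size b %/ n) => //.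
case: (size b %/ n) size_b => [|q] size_b; first exact: size0nil.
rewrite -[LHS](cat_take_drop n) repS; congr (_ ++ _).
(* Invariance under [rot n] says that the prefix of length [n] commutes with the rest. *)
apply: comm_rep; last by rewrite size_drop size_b size_takel // mulSn addKn.
by rewrite cat_take_drop -[LHS]rot_n.
Qed.

End Repetition.

(** * Lyndon words *)

(** Strict minimality forces aperiodicity: a proper power of [e] is fixed by the rotation by
    [size e]. *)
Lemma lyndonP a :
  reflect (forall i, 0 < i < size a -> (a < rot i a)%O) (lyndon a).
Proof.
apply: (iffP andP) => [[_ /forallP least] i /andP[i_gt0 lt_i] | least].
  exact: (implyP (least (Ordinal lt_i))).
split; last by apply/forallP => i; apply/implyP => i_gt0; apply: least; rewrite i_gt0 /=.
apply/aperiodicP => -[e [k [lt_ea lt1k def_a]]].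
have e_gt0 : 0 < size e.
  by rewrite lt0n; apply: contraTneq lt_ea => e0; rewrite def_a -/(rep k e) size_rep e0 muln0.
have := least (size e); rewrite e_gt0 lt_ea => /(_ isT).
by rewrite {2}def_a -/(rep k e) rot_rep // rot_size /rep -def_a Order.POrderTheory.ltxx.
Qed.

Lemma lyndon_rot_fix a i : lyndon a -> i < size a -> rot i a = a -> i = 0.
Proof.
case: i => // i /lyndonP least lt_i rot_i.
by have := least i.+1; rewrite lt_i rot_i Order.POrderTheory.ltxx => /(_ isT).
Qed.

(** The common word has period [size a], so rotation by [size a] modulo [size a'] fixes [a']; only
    the trivial rotation fixes a Lyndon word. *)
Lemma lyndon_rep_size a a' k k' r r' :
    lyndon a -> lyndon a' -> 0 < size a' -> 0 < k -> 0 < k' -> r < size a -> r' < size a' ->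
    rep k (rot r a) = rep k' (rot r' a') ->
  size a' %| size a.
Proof.
move=> lyn_a lyn_a' a'_gt0 k_gt0 k'_gt0 lt_r lt_r' eq_rep.
have fixed : rot (size a) (rep k' (rot r' a')) = rep k' (rot r' a').
  by rewrite -eq_rep rot_rep ?size_rot // -[in rot (size a)](size_rot r a) rot_size.
move: fixed; rewrite rot_rep_mod; last first.
  by rewrite -eq_rep size_rep size_rot leq_pmull.
rewrite size_rot; move/(rep_inj k'_gt0); rewrite !size_rot => /(_ erefl).
rewrite rot_rot => /rot_inj fix_a'; apply/eqP.
by apply: (lyndon_rot_fix lyn_a') fix_a'; rewrite ltn_mod.
Qed.

Lemma lyndon_le_rot a i : lyndon a -> (a <= rot i a)%O.
Proof.
move=> /lyndonP least; have [->|i_gt0] := posnP i; first by rewrite rot0.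
have [le_i|lt_i] := leqP (size a) i; first by rewrite rot_oversize.
by apply/Order.POrderTheory.ltW/least; rewrite i_gt0.
Qed.

(** Each word is a rotation of the other, so each is at most the other; the difference of the two
    offsets then fixes [a]. *)
Lemma lyndon_rot_inj a a' r r' :
    lyndon a -> lyndon a' -> r < size a -> r' < size a' ->
  rot r a = rot r' a' -> a = a' /\ r = r'.
Proof.
move=> lyn_a lyn_a' lt_r lt_r' eq_rot.
have le_lyndon b c i j : lyndon b -> rot i b = rot j c -> (b <= c)%O.
  move=> lyn_b /(canLR (rotK j)) <-.
  by rewrite /rotr rot_rot_add lyndon_le_rot.
have eq_a : a = a'.
  by apply/Order.POrderTheory.le_anti; rewrite (le_lyndon a a' r r') ?(le_lyndon a' a r' r).
split=> //; rewrite -{}eq_a in lt_r' eq_rot {lyn_a'}.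
wlog le_r : r r' lt_r lt_r' eq_rot / r <= r'.
  by move=> IH; case/orP: (leq_total r r') => le_r; [|apply: esym]; apply: IH.
move: eq_rot; rewrite -(subnKC le_r) rotD; last by rewrite subnKC // ltnW.
move=> /rot_inj/esym fix_a.
by rewrite (lyndon_rot_fix lyn_a _ fix_a) ?addn0 // (leq_ltn_trans (leq_subr _ _)).
Qed.

(** With [n] the least positive rotation fixing [b], the word [b] is a power of its prefix [c] of
    length [n]. No proper rotation fixes [c], so its least rotation is Lyndon. *)
Lemma ex_lyndon_rot_rep b : 0 < size b ->
  exists a k r, [/\ lyndon a, 0 < k, r < size a & b = rep k (rot r a)].
Proof.
move=> b_gt0.
have ex_fix : exists n, (0 < n) && (rot n b == b).
  by exists (size b); rewrite b_gt0 rot_size eqxx.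
case: (ex_minnP ex_fix) => n /andP[n_gt0 /eqP fix_n] min_n.
have rot_lt i : 0 < i < n -> rot i b != b.
  move=> /andP[i_gt0 lt_in]; apply: contraTneq lt_in => fix_i.
  by rewrite -leqNgt min_n // i_gt0 fix_i /=.
have [k def_b size_b] := rot_fix_rep n_gt0 fix_n rot_lt.
set c := take n b in def_b.
have k_gt0 : 0 < k by case: k size_b {def_b} => // b0; rewrite b0 in b_gt0.
have size_c : size c = n by rewrite size_takel // size_b leq_pmull.
pose z := Ordinal n_gt0.
have [i0 _ least] := @Order.TotalTheory.arg_minP _ _ 'I_n z xpredT (fun i => rot i c) isT.
pose a := rot i0 c.
have size_a : size a = n by rewrite size_rot.
have rot_a i : 0 < i < n -> rot i a != a.
  move=> /andP[i_gt0 lt_i]; have := rot_lt i; rewrite i_gt0 lt_i => /(_ isT).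
  apply: contraNneq; rewrite /a rot_rot => /rot_inj fix_c.
  by rewrite def_b rot_rep ?size_c 1?ltnW // fix_c.
have le_a i : (a <= rot i c)%O.
  have [le_i|lt_i] := leqP (size c) i; last first.
    by rewrite size_c in lt_i; apply: (least (Ordinal lt_i)).
  by rewrite rot_oversize // -[X in (_ <= X)%O]rot0; apply: (least z).
(* Rotation by [n - i0] undoes [rot i0]; for [i0 = 0] this would be [n], outside the range of
   [r]. *)
exists a, k, (if i0 == z then 0 else n - i0); split=> //.
- apply/lyndonP => i; rewrite size_a => /rot_a neq_a.
  by rewrite Order.POrderTheory.lt_neqAle eq_sym neq_a {2}/a rot_rot_add le_a.
- by rewrite size_a; case: eqP => // /eqP; rewrite -val_eqE /=; lia.
rewrite [LHS]def_b; congr (rep k _); case: eqP => [i00|_].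
  by rewrite /a i00 !rot0.
by rewrite -[LHS](rotK i0) -/a /rotr size_a.
Qed.

(** * Compositions as powers of rotated Lyndon compositions *)

Lemma sumn_rep k c : sumn (rep k c) = k * sumn c.
Proof. by elim: k => // k IH; rewrite repS sumn_cat IH. Qed.

Lemma mem_lyndon_compositions d a :
  (a \in lyndon_compositions d) = [&& lyndon a, all (leq 1) a & sumn a == d].
Proof. by rewrite mem_filter mem_compositions. Qed.

Lemma sum_compositions_lyndon (F : seq nat -> nat) m : 0 < m ->
  \sum_(b <- compositions m) F b =
  \sum_(d <- divisors m) \sum_(a <- lyndon_compositions d)
    \sum_(r <- iota 0 (size a)) F (rep (m %/ d) (rot r a)).
Proof.
move=> m_gt0.
(* Pooling all divisors loses nothing: [d] is recovered as [sumn a]. *)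
pose L := [seq a | d <- divisors m, a <- lyndon_compositions d].
have memL a : reflect [/\ lyndon a, all (leq 1) a & sumn a %| m] (a \in L).
  apply: (iffP allpairsPdep) => [[d [a1 [dm + ->]]] | [lyn_a a_pos dvd_m]].
    rewrite mem_lyndon_compositions => /and3P[-> -> /eqP->].
    by split=> //; rewrite dvdn_divisors.
  exists (sumn a), a; split=> //; first by rewrite -dvdn_divisors.
  by rewrite mem_lyndon_compositions lyn_a a_pos eqxx.
have sum_gt0 a : a \in L -> 0 < sumn a.
  by case/memL => _ _ /dvdn_gt0->.
have size_gt0 a : a \in L -> 0 < size a.
  by move=> /sum_gt0; case: a.
pose B := [seq rep (m %/ sumn a) (rot r a) | a <- L, r <- iota 0 (size a)].
rewrite (perm_big B) /=.
  rewrite !big_allpairs_dep /=; apply: eq_bigr => d _; apply: eq_big_seq => a.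
  by rewrite mem_lyndon_compositions => /and3P[_ _ /eqP->].
apply: uniq_perm; first exact: compositions_uniq.
  apply: allpairs_uniq_dep => [|a _|]; last 2 first.
  - exact: iota_uniq.
  - move=> p p' /allpairsPdep[a [r [La r_lt ->]]].
    move=> /allpairsPdep[a' [r' [La' r'_lt ->]]] /= eq_rep.
    rewrite !mem_iota !add0n /= in r_lt r'_lt.
    have [/memL[lyn_a _ dvd_a] /memL[lyn_a' _ dvd_a']] := (La, La').
    have k_gt0 : 0 < m %/ sumn a by rewrite divn_gt0 ?sum_gt0 // dvdn_leq.
    have k'_gt0 : 0 < m %/ sumn a' by rewrite divn_gt0 ?sum_gt0 // dvdn_leq.
    (* Divisibility holds in both directions; equal sizes then give equal exponents, and
       [lyndon_rot_inj] finishes. *)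
    have eq_size : size a = size a'.
      apply/eqP; rewrite eqn_dvd.
      rewrite (lyndon_rep_size lyn_a' lyn_a _ k'_gt0 k_gt0 r'_lt r_lt) ?size_gt0 //.
      by rewrite (lyndon_rep_size lyn_a lyn_a' _ k_gt0 k'_gt0 r_lt r'_lt) ?size_gt0.
    have eq_k : m %/ sumn a = m %/ sumn a'.
      move/(congr1 size): eq_rep; rewrite !size_rep !size_rot eq_size => /eqP.
      by rewrite eqn_pmul2r ?size_gt0 // => /eqP.
    rewrite eq_k in eq_rep; move/(rep_inj k'_gt0): eq_rep.
    rewrite !size_rot => /(_ eq_size) /lyndon_rot_inj[] //.
    by move=> -> ->.
  apply: allpairs_uniq_dep => [|d _|]; first exact: divisors_uniq.
    by rewrite filter_uniq ?compositions_uniq.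
  move=> p p' /allpairsPdep[d [a [_ + ->]]] /allpairsPdep[d' [a' [_ + ->]]] /= eq_a.
  rewrite !mem_lyndon_compositions eq_a => /and3P[_ _ /eqP<-] /and3P[_ _ /eqP<-].
  by [].
move=> b; rewrite mem_compositions; apply/andP/allpairsPdep => [[b_pos /eqP sum_b]|].
  have b_gt0 : 0 < size b by case: b sum_b {b_pos} => // m0; rewrite -m0 in m_gt0.
  have [a [k [r [lyn_a k_gt0 lt_r def_b]]]] := ex_lyndon_rot_rep b_gt0.
  have sum_m : m = k * sumn a.
    by rewrite -sum_b def_b sumn_rep (perm_sumn (_ : perm_eq (rot r a) a)) // perm_rot.
  have a_pos : all (leq 1) a.
    have : all (leq 1) (rot r a).
      case: k k_gt0 def_b {sum_m} => // k _ def_b.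
      by move: b_pos; rewrite def_b repS all_cat => /andP[].
    by rewrite (perm_all _ (_ : perm_eq (rot r a) a)) // perm_rot.
  exists a, r; rewrite mem_iota lt_r sum_m mulnK; last first.
    by move: m_gt0; rewrite sum_m muln_gt0 => /andP[].
  by split=> //; apply/memL; rewrite sum_m dvdn_mull.
move=> [a [r [La _ ->]]]; have /memL[_ a_pos dvd_a] := La.
have perm_a : perm_eq (rot r a) a by rewrite perm_rot.
rewrite sumn_rep (perm_sumn perm_a) divnK // eqxx; split=> //.
by elim: (_ %/ _) => // k IH; rewrite repS all_cat IH (perm_all _ perm_a) a_pos.
Qed.

(** * Path weights and the final count *)

Definition path_weight (a : seq nat) := \prod_(x <- a) num_compositions (path_graph (x - 1)).

(** The exponent is that of [cyclic_zero_pairs_spell]; truncation at [x = 1] matches the convention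
    for the empty path. *)
Lemma path_weightE a : path_weight a = 2 ^ \sum_(x <- a) (x - 1).-1.
Proof.
rewrite /path_weight; elim: a => [|x a IH]; first by rewrite !big_nil.
by rewrite !big_cons IH expnD num_compositions_path.
Qed.

Lemma path_weight_rep k r a : path_weight (rep k (rot r a)) = path_weight a ^ k.
Proof.
elim: k => [|k IH]; first by rewrite /path_weight big_nil.
rewrite repS expnS -IH /path_weight big_cat /=; congr (_ * _).
by apply: perm_big; rewrite perm_rot.
Qed.

(** The word [rot r a] starts with entry [r] of [a], so each part of [a] occurs once as a head. *)
Lemma sum_head_rep_rot k a :
  0 < k -> \sum_(r <- iota 0 (size a)) head 0 (rep k (rot r a)) = sumn a.
Proof.
case: k => // k _; rewrite sumnE [RHS](big_nth 0) /index_iota subn0.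
apply: eq_big_seq => r; rewrite mem_iota add0n /= => lt_r.
by rewrite /rot (drop_nth 0).
Qed.

Lemma perm_lyndon_compositions1 : perm_eq (lyndon_compositions 1) [:: [:: 1]].
Proof.
apply: uniq_perm => [||a] //; first by rewrite filter_uniq ?compositions_uniq.
rewrite mem_lyndon_compositions inE; apply/and3P/eqP => [[_ a_pos /eqP sum_a] | ->].
  case: a a_pos sum_a => [|[|[|x]] [|[|y] a]] //.
by split=> //; apply/lyndonP => -[].
Qed.

Lemma sum_free_edges m : 0 < m ->
  \sum_(S : {set 'I_m} | S != set0) 2 ^ #|free_edges S| =
  \sum_(d <- divisors m) d * \sum_(a <- lyndon_compositions d) path_weight a ^ (m %/ d).
Proof.
move=> m_gt0.
rewrite (eq_bigr (fun S => 2 ^ cyclic_zero_pairs (indicator S))) => [|S _]; last first.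
  by rewrite card_free_edges.
rewrite (sum_nonempty_sets (fun w => 2 ^ cyclic_zero_pairs w)) //.
(* The weight does not depend on the offset, so the offsets contribute only their number, the first
   part of [b]. *)
transitivity (\sum_(b <- compositions m) head 0 b * path_weight b).
  apply: eq_bigr => b _.
  under eq_bigr => o _ do rewrite cyclic_zero_pairs_rot cyclic_zero_pairs_spell -path_weightE.
  by rewrite big_const_seq count_predT size_iota iter_addn_0 mulnC.
rewrite sum_compositions_lyndon //; apply: eq_big_seq => d.
rewrite -dvdn_divisors // => dvd_d; rewrite big_distrr /=; apply: eq_big_seq => a.
rewrite mem_lyndon_compositions => /and3P[_ _ /eqP sum_a].
under eq_bigr => r _ do rewrite path_weight_rep.
have k_gt0 : 0 < m %/ d by rewrite divn_gt0 (dvdn_gt0 m_gt0 dvd_d, dvdn_leq m_gt0 dvd_d).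
by rewrite -big_distrl /= (sum_head_rep_rot _ k_gt0) sum_a.
Qed.

Theorem theorem8 (n : nat) (n_ge2 : (2 <= n)%N) :
  ((num_compositions (wheel n))%:Z =
   2 ^+ (n - 1) - n%:Z + 2
   + (\sum_(d <- divisors (n - 1) | 1 < d)
        d * \sum_(a <- lyndon_compositions d)
              (\prod_(x <- a) num_compositions (path_graph (x - 1)))
                ^ ((n - 1) %/ d))%N%:Z :> int)%R.
Proof.
case: n n_ge2 => [|[|m]] // _; rewrite subn1 /=; set R := \sum_(d <- _ | _) _.
(* Moving [m.+1] to the left avoids subtraction in [nat]. The [1] is the term of the divisor [1],
   which turns [- (n - 1)] into [- n + 2]. *)
have : num_compositions (wheel m.+2) + m.+1 = 2 ^ m.+1 + (1 + R).
  rewrite num_compositions_wheel (bigD1 set0) //= sum_free_edges //.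
  congr (_ + _).
    have -> : free_edges set0 = [set: 'I_m.+1] by apply/setP => i; rewrite !inE.
    by rewrite cardsT card_ord.
  rewrite (bigD1_seq 1) ?divisors_uniq -?dvdn_divisors //=; congr (_ + _).
    rewrite mul1n (perm_big _ perm_lyndon_compositions1) big_seq1 path_weightE.
    by rewrite big_seq1 exp1n.
  rewrite big_seq_cond [RHS]big_seq_cond; apply: eq_bigl => d.
  rewrite -dvdn_divisors //; case dvd_d: (d %| _) => //=.
  by have := dvdn_gt0 (ltn0Sn _) dvd_d; case: d {dvd_d} => [|[|d]].
move=> /(congr1 Posz); rewrite !PoszD => eq_num.
have : ((2 ^ m.+1)%:Z = 2 ^+ m.+1)%R by rewrite -natz GRing.natrX.
lia.
Qed.
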